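(* Let $R$ be a left and right noetherian ring, $n\geq 1$, and let $A$ be any $n$-syzygy module in the category of finitely generated left $R$-modules. Then for every $0\leq i\leq n-1$, $I_i(A)$ is a direct summand of a direct sum of copies of $\bigoplus_{j\leq i} I_j(R)$.
   Context: A finitely generated left $R$-module $M$ is an $n$-syzygy module if there is an exact sequence $0\to M\to P_{n-1}\to\cdots\to P_1\to P_0\to A'\to 0$ of finitely generated left $R$-modules with every $P_i$ projective. For a module $M$, $0\to M\to I_0(M)\to I_1(M)\to\cdots$ denotes its minimal injective resolution; $I_j(R)$ refers to $R$ as a left $R$-module. Up to isomorphism is understood in ''direct summand''. *)

(* Defs.v *)
From HB Require Import structures.
From mathcomp Require Import all_boot all_algebra.
From mathcomp Require Import boolp classical_sets functions cardinality.

Set Implicit Arguments.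
Unset Strict Implicit.
Unset Printing Implicit Defensive.

Import GRing.Theory.
Local Open Scope ring_scope.

(* Unital, not necessarily commutative rings are [pzRingType]s (the zero ring
   is allowed) and left modules are [lmodType]s. *)

(* Direct sum of an arbitrary family of modules, as the module of finitely
   supported dependent functions. *)
Section DirectSum.
Variables (R : pzRingType) (X : Type) (F : X -> lmodType R).

Record dsum : Type := DSum {
  dsum_val :> forall x, F x ;
  dsum_finite : finite_set [set x | dsum_val x != 0]%classic
}.

HB.instance Definition _ := gen_eqMixin dsum.
HB.instance Definition _ := gen_choiceMixin dsum.

Lemma dsumP (u v : dsum) : (forall x, u x = v x) -> u = v.
Proof.
case: u v => [f fP] [g gP] /= fg.
have {}fg : f = g by exact: functional_extensionality_dep.
by subst g; congr DSum; exact: Prop_irrelevance.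
Qed.

Fact dsum0_finite : finite_set [set x | (0 : F x) != 0]%classic.
Proof. by apply: (sub_finite_set _ (@finite_set0 X)) => x /=; rewrite eqxx. Qed.

Fact dsumD_finite (u v : dsum) :
  finite_set [set x | u x + v x != 0]%classic.
Proof.
have fUV : finite_set ([set x | u x != 0] `|` [set x | v x != 0])%classic.
  by rewrite finite_setU; split; exact: dsum_finite.
apply: sub_finite_set fUV => x /= uv; have [u0|] := eqVneq (u x) 0; last by left.
by right; move: uv; rewrite u0 add0r.
Qed.

Fact dsumN_finite (u : dsum) : finite_set [set x | - u x != 0]%classic.
Proof. by apply: sub_finite_set (dsum_finite u) => x /=; rewrite oppr_eq0. Qed.

Fact dsumZ_finite (a : R) (u : dsum) :
  finite_set [set x | a *: u x != 0]%classic.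
Proof.
apply: sub_finite_set (dsum_finite u) => x /=.
by apply: contra_neq => ->; rewrite scaler0.
Qed.

Definition dsum0 : dsum := DSum dsum0_finite.
Definition dsumD (u v : dsum) : dsum := DSum (dsumD_finite u v).
Definition dsumN (u : dsum) : dsum := DSum (dsumN_finite u).
Definition dsumZ (a : R) (u : dsum) : dsum := DSum (dsumZ_finite a u).

Fact dsumDA : associative dsumD.
Proof. by move=> u v w; apply: dsumP => x /=; rewrite addrA. Qed.
Fact dsumDC : commutative dsumD.
Proof. by move=> u v; apply: dsumP => x /=; rewrite addrC. Qed.
Fact dsum0D : left_id dsum0 dsumD.
Proof. by move=> u; apply: dsumP => x /=; rewrite add0r. Qed.
Fact dsumND : left_inverse dsum0 dsumN dsumD.
Proof. by move=> u; apply: dsumP => x /=; rewrite addNr. Qed.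

HB.instance Definition _ :=
  GRing.isZmodule.Build dsum dsumDA dsumDC dsum0D dsumND.

Fact dsumZA a b u : dsumZ a (dsumZ b u) = dsumZ (a * b) u.
Proof. by apply: dsumP => x /=; rewrite scalerA. Qed.
Fact dsum1Z : left_id 1 dsumZ.
Proof. by move=> u; apply: dsumP => x /=; rewrite scale1r. Qed.
Fact dsumZDr : right_distributive dsumZ +%R.
Proof. by move=> a u v; apply: dsumP => x /=; rewrite scalerDr. Qed.
Fact dsumZDl u : {morph dsumZ^~ u : a b / a + b}.
Proof. by move=> a b; apply: dsumP => x /=; rewrite scalerDl. Qed.

HB.instance Definition _ :=
  GRing.Zmodule_isLmodule.Build R dsum dsumZA dsum1Z dsumZDr dsumZDl.

End DirectSum.

Section Modules.
Variable R : pzRingType.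

Definition noetherian_module (M : lmodType R) : Prop :=
  forall S : nat -> {pred M},
    (forall k, submod_closed (S k)) ->
    (forall k, {subset S k <= S k.+1}) ->
    exists m, forall k, (m <= k)%N -> S k =i S m.

Definition finitely_generated (M : lmodType R) : Prop :=
  exists (r : nat) (v : 'I_r -> M),
    forall x : M, exists c : 'I_r -> R, x = \sum_(i < r) c i *: v i.

Definition surjective (M N : lmodType R) (f : M -> N) : Prop :=
  forall y, exists x, f x = y.

Definition exact_at (L M N : lmodType R) (f : L -> M) (g : M -> N) : Prop :=
  forall y : M, g y = 0 <-> exists x : L, f x = y.

Definition projective (P : lmodType R) : Prop :=
  forall (M N : lmodType R) (g : {linear M -> N}) (f : {linear P -> N}),
    surjective g -> exists h : {linear P -> M}, forall x, g (h x) = f x.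

Definition injective_module (E : lmodType R) : Prop :=
  forall (M N : lmodType R) (i : {linear M -> N}) (f : {linear M -> E}),
    injective i -> exists h : {linear N -> E}, forall x, h (i x) = f x.

(* The image of [f] is an essential submodule of [E]: it meets every nonzero
   submodule of [E] nontrivially. *)
Definition essential_image (M E : lmodType R) (f : M -> E) : Prop :=
  forall S : {pred E}, submod_closed S ->
    (exists2 y, y \in S & y != 0) ->
    exists x : M, f x \in S /\ f x != 0.

Definition direct_summand (N M : lmodType R) : Prop :=
  exists (C : lmodType R) (f : {linear (N * C)%type -> M}), bijective f.

(* In the exact sequence 0 -> M -> P_(n-1) -> ... -> P_0 -> A' -> 0, the module
   [X 0] is A', [X k.+1] is P_k for k < n, and M is identified with [X n.+1]
   through [e]; the terms beyond [X n.+1] are irrelevant. *)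
Definition is_syzygy (n : nat) (M : lmodType R) : Prop :=
  exists (X : nat -> lmodType R) (d : forall k, {linear X k.+1 -> X k})
         (e : {linear M -> X n.+1}),
    [/\ bijective e,
        injective (d n),
        forall k, (k < n)%N -> exact_at (d k.+1) (d k),
        surjective (d 0%N) &
        (forall k, (k <= n.+1)%N -> finitely_generated (X k)) /\
        (forall k, (k < n)%N -> projective (X k.+1))].

(* An injective resolution 0 -> M -> I_0 -> I_1 -> ... is minimal when I_0 is
   an injective envelope of M and each I_(k+1) is an injective envelope of the
   image of I_k -> I_(k+1). *)
Record min_inj_resolution (M : lmodType R) := MinInjResolution {
  mir_obj :> nat -> lmodType R ;
  mir_aug : {linear M -> mir_obj 0%N} ;
  mir_diff : forall k, {linear mir_obj k -> mir_obj k.+1} ;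
  mir_injective : forall k, injective_module (mir_obj k) ;
  mir_aug_inj : injective mir_aug ;
  mir_exact0 : exact_at mir_aug (mir_diff 0%N) ;
  mir_exact : forall k, exact_at (mir_diff k) (mir_diff k.+1) ;
  mir_essential0 : essential_image mir_aug ;
  mir_essential : forall k, essential_image (mir_diff k)
}.

End Modules.

Definition left_noetherian (R : pzRingType) : Prop :=
  noetherian_module (R^o : lmodType R).

(* Right ideals of [R] are left ideals of the converse ring [R^c]. *)
Definition right_noetherian (R : pzRingType) : Prop :=
  left_noetherian R^c.

(* Main.v *)
Require Import Defs.
From HB Require Import structures.
From mathcomp Require Import all_boot all_algebra.
From mathcomp Require Import boolp classical_sets cardinality.

Set Implicit Arguments.
Unset Strict Implicit.
Unset Printing Implicit Defensive.

Import GRing.Theory.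
Local Open Scope ring_scope.

(** An [n]-syzygy [A] sits in short exact sequences 0 -> A -> P -> B -> 0 with
[P] finitely generated projective and [B] an [(n-1)]-syzygy.  If [P] and [B]
have injective resolutions [Y] and [Z], lift [P -> B] to a chain map
[f : Y -> Z]; its mapping cone, with the two terms [P] and [B] removed,

  0 -> A -> Y_0 -> Y_1 + Z_0 -> Y_2 + Z_1 -> ...

is an injective resolution of [A] ([coresolvable_kernel]).  Suppose that [Y_k]
and [Z_k] embed in finite sums of copies of I_0(R), ..., I_k(R); then so does
the term [Y_k + Z_(k-1)] of this resolution.  It thus suffices to treat
projective modules.  For a finite free module take a power of
the minimal resolution of [R].  A finitely generated projective [P] is again
the kernel of a surjection from a finite free module onto a module of the same
kind, its complement, so the same mapping cone reaches any length
([coresolvable_retract]).  This gives [A] an injective resolution [J], exact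
as far as degree [n - 2] and with [J_0], ..., [J_(n-1)] of the required form
([coresolvable_syzygy]).

The minimal resolution [I] of [A] embeds termwise in [J]: chain maps
[f : I -> J] and [g : J -> I] over the identity of [A] exist, [g f] is homotopic
to the identity, and minimality makes each component of such an endomorphism
injective ([minimal_retract_injective]).  So [I_i] embeds in [J_i], which
embeds in a direct sum of copies of I_0(R) + ... + I_i(R), and an embedding of
an injective module splits. *)

(** * Sequences of dependent choices *)

(** Chain maps and homotopies are built degree by degree, where each new
component depends on the previous one through the relation [Q].  Requiring a
successor only for pairs related by [Q] carries the invariant along. *)
Lemma dependent_chain (T : nat -> Type) (Q : forall k, T k -> T k.+1 -> Prop)
    (t0 : T 0%N) :
  (exists t1, Q 0%N t0 t1) ->
  (forall k a b, Q k a b -> exists c, Q k.+1 b c) ->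
  exists t : forall k, T k, t 0%N = t0 /\ forall k, Q k (t k) (t k.+1).
Proof.
move=> /cid[t1 Q01] step.
pose S k := {p : T k * T k.+1 | Q k p.1 p.2}.
pose next k (s : S k) : S k.+1 :=
  let: exist p Qp := s in
  let: exist c Qc := cid (step k _ _ Qp) in
  exist (fun p => Q k.+1 p.1 p.2) (p.2, c) Qc.
pose F := nat_rect S (exist _ (t0, t1) Q01) next.
have nextE k (s : S k) : (sval (next k s)).1 = (sval s).2.
  by case: s => p Qp /=; case: (cid _).
exists (fun k => (sval (F k)).1); split=> // k.
by rewrite -/(F k) /= nextE; exact: (svalP (F k)).
Qed.

(** * The image of a linear map as a module *)

Section Image.
Variables (R : pzRingType) (M N : lmodType R) (f : {linear M -> N}).

Definition image_pred : {pred N} := fun y => `[< exists x, f x = y >].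

Fact image_pred_closed : submod_closed image_pred.
Proof.
split=> [|a _ _ /asboolP[x <-] /asboolP[y <-]]; apply/asboolP.
  by exists 0; rewrite linear0.
by exists (a *: x + y); rewrite linearP.
Qed.

HB.instance Definition _ :=
  GRing.isSubmodClosed.Build R N image_pred image_pred_closed.

Record image_module : Type :=
  ImageModule { im_val : N; _ : im_val \in image_pred }.
HB.instance Definition _ := [isSub for im_val].
HB.instance Definition _ := [Choice of image_module by <:].
HB.instance Definition _ := [SubChoice_isSubLmodule of image_module by <:].

Definition im_incl : {linear image_module -> N} := val.

Lemma im_incl_inj : injective im_incl.
Proof. exact: val_inj. Qed.

Lemma im_inclP (y : image_module) : exists x, f x = im_incl y.
Proof. by case: y => y /= /asboolP. Qed.

Fact im_mem x : f x \in image_pred.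
Proof. by apply/asboolP; exists x. Qed.

Definition im_corestr (x : M) : image_module := ImageModule (im_mem x).

Fact im_corestr_linear : linear im_corestr.
Proof. by move=> a x y; apply: val_inj; rewrite /= !linearP. Qed.

HB.instance Definition _ :=
  GRing.isLinear.Build R M image_module *:%R im_corestr im_corestr_linear.

Lemma im_corestr_surj : surjective im_corestr.
Proof. by move=> y; have [x xy] := im_inclP y; exists x; apply: val_inj. Qed.

End Image.

Arguments im_incl {R M N} f.

Section Modules.
Variable R : pzRingType.
Implicit Types M N E A B F P : lmodType R.

Lemma linear_injective M N (f : {linear M -> N}) :
  (forall x, f x = 0 -> x = 0) -> injective f.
Proof.
by move=> f0 x y fxy; apply/eqP; rewrite -subr_eq0; apply/eqP/f0;
  rewrite linearB fxy subrr.
Qed.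

Lemma linear_injective0 M N (f : {linear M -> N}) :
  injective f -> forall x, f x = 0 -> x = 0.
Proof. by move=> f_inj x fx0; apply: f_inj; rewrite fx0 linear0. Qed.

(** The lifting step of every construction below: a map out of [M] that vanishes
on the kernel of [d] factors through the image of [d], a submodule of [N], from
which it extends to [N] by injectivity of [E]. *)
Lemma extend_along M N E (d : {linear M -> N}) (f : {linear M -> E}) :
  injective_module E -> (forall x, d x = 0 -> f x = 0) ->
  exists h : {linear N -> E}, forall x, h (d x) = f x.
Proof.
move=> E_inj df.
have dfE x y : d x = d y -> f x = f y.
  move=> dxy; apply/eqP; rewrite -subr_eq0 -linearB; apply/eqP/df.
  by rewrite linearB dxy subrr.
pose g (y : image_module d) : E := f (sval (cid (im_inclP y))).
have gE x y : d x = im_incl d y -> g y = f x.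
  by rewrite /g; case: cid => /= x' <- /esym /dfE.
have g_lin : linear g.
  move=> a y z; have [v vy] := im_inclP y; have [w wz] := im_inclP z.
  rewrite (gE _ _ vy) (gE _ _ wz) -linearP; apply: gE.
  by rewrite !linearP vy wz.
pose gM := GRing.isLinear.Build R _ _ _ g g_lin.
pose gL : {linear image_module d -> E} := HB.pack g gM.
have [h hE] := E_inj _ _ (im_incl d) gL (@im_incl_inj _ _ _ d).
exists h => x; have := hE (im_corestr d x); rewrite [im_incl d _]/= => ->.
exact: gE.
Qed.

(** * Chain maps and homotopies of truncated complexes

Complexes are augmented: degree 0 holds the resolved module, so the terms of
the resolution start in degree 1. *)

Definition exact_upto (n : nat) (X : nat -> lmodType R)
    (d : forall k, {linear X k -> X k.+1}) : Prop :=
  ((0 < n)%N -> injective (d 0%N)) /\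
  forall k, (k.+1 < n)%N -> exact_at (d k) (d k.+1).

Definition chain_upto (n : nat) (X Y : nat -> lmodType R)
    (dX : forall k, {linear X k -> X k.+1})
    (dY : forall k, {linear Y k -> Y k.+1})
    (f : forall k, {linear X k -> Y k}) : Prop :=
  forall k, (k < n)%N -> forall x, f k.+1 (dX k x) = dY k (f k x).

Lemma exact_upto_dd n X d : @exact_upto n X d ->
  forall k, (k.+1 < n)%N -> forall x, d k.+1 (d k x) = 0.
Proof. by move=> [_ ex] k kn x; apply/(ex k kn); exists x. Qed.

(** Comparison theorem: [f_(k+1)] extends [d f_k] along [d], which is possible
because [d f_k] kills the image of the previous differential, the kernel of [d].
Only the components up to degree [n] matter; the others are taken to be zero. *)
Lemma lift_chain n (X Y : nat -> lmodType R)
    (dX : forall k, {linear X k -> X k.+1})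
    (dY : forall k, {linear Y k -> Y k.+1}) (f0 : {linear X 0%N -> Y 0%N}) :
  exact_upto n dX -> exact_upto n dY ->
  (forall k, injective_module (Y k.+1)) ->
  exists f : forall k, {linear X k -> Y k}, f 0%N = f0 /\ chain_upto n dX dY f.
Proof.
move=> [X0 Xex] /exact_upto_dd Ydd Y_inj.
apply: (@dependent_chain (fun k => {linear X k -> Y k})
  (fun k a b => (k < n)%N -> forall x, b (dX k x) = dY k (a x))).
- have [n0|n0] := ltnP 0 n; last by exists \0%R.
  have /(_ _)[|h hE] :=
    @extend_along _ _ _ (dX 0%N) (dY 0%N \o f0 : {linear _ -> _}) (Y_inj 0%N).
    by move=> x /(linear_injective0 (X0 n0)) ->; rewrite linear0.
  by exists h.
- move=> k a b Q; have [kn|kn] := ltnP k.+1 n; last by exists \0%R.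
  have /(_ _)[|h hE] := @extend_along _ _ _ (dX k.+1)
    (dY k.+1 \o b : {linear _ -> _}) (Y_inj k.+1).
    by move=> x /(Xex k kn)[w <-] /=; rewrite (Q (ltnW kn)) Ydd.
  by exists h.
Qed.

(** A chain map over the zero map is null-homotopic: [h_(k+1)] extends
[u_(k+1) - d h_k] along [d].  One more degree of exactness is needed than the
range of [u], since the last homotopy starts from the differential that leaves
the last component. *)
Lemma null_homotopy n (X Y : nat -> lmodType R)
    (dX : forall k, {linear X k -> X k.+1})
    (dY : forall k, {linear Y k -> Y k.+1})
    (u : forall k, {linear X k -> Y k}) :
  exact_upto n.+1 dX -> exact_upto n.+1 dY ->
  (forall k, injective_module (Y k.+1)) ->
  chain_upto n dX dY u -> (forall x, u 0%N x = 0) ->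
  exists h : forall k, {linear X k.+1 -> Y k}, (forall x, h 0%N x = 0) /\
    forall k, (k < n)%N -> forall x,
      u k.+1 x = h k.+1 (dX k.+1 x) + dY k (h k x).
Proof.
move=> [_ Xex] /exact_upto_dd Ydd Y_inj uch u0.
have [||h [h0 hE]] := @dependent_chain (fun k => {linear X k.+1 -> Y k})
  (fun k a b => (k < n)%N -> forall x,
     u k.+1 x = b (dX k.+1 x) + dY k (a x)) \0%R; last first.
- by exists h; split=> // x; rewrite h0.
- move=> k a b Q; have [kn|kn] := ltnP k.+1 n; last by exists \0%R.
  have /(_ _)[|h hE] := @extend_along _ _ _ (dX k.+2)
    (u k.+2 \- (dY k.+1 \o b) : {linear _ -> _}) (Y_inj k.+1).
    move=> x /(Xex k.+1 kn)[w <-] /=.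
    rewrite (uch _ kn) (Q (ltnW kn)) linearD Ydd 1?ltnW //.
    by rewrite addr0 subrr.
  by exists h => _ x; rewrite hE /= subrK.
- have [n0|n0] := ltnP 0 n; last by exists \0%R.
  have /(_ _)[|h hE] := @extend_along _ _ _ (dX 1%N) (u 1%N) (Y_inj 0%N).
    by move=> x /(Xex 0%N n0)[w <-]; rewrite uch // u0 linear0.
  by exists h => _ x; rewrite hE /= linear0 addr0.
Qed.

(** Let [z] be a cycle killed by [u].  As [u - 1 = hd + dh], it satisfies
[z = - d (h z)], so [h] is injective on the submodule [K] of such cycles, and
[h K] contains no nonzero cycle: if [d (h z) = 0] then [z = 0].  But boundaries
are essential, so [h K = 0] and [K = 0].  By essentiality once more, a nonzero
kernel of [u] would contain a nonzero boundary, which lies in [K]. *)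
Lemma minimal_retract_injective n (X : nat -> lmodType R)
    (d : forall k, {linear X k -> X k.+1}) (u : forall k, {linear X k -> X k}) :
  exact_upto n.+1 d -> (forall k, injective_module (X k.+1)) ->
  (forall k, essential_image (d k)) ->
  chain_upto n d d u -> (forall x, u 0%N x = x) ->
  forall k, (k < n)%N -> injective (u k.+1).
Proof.
move=> dex X_inj ess uch u0.
pose v k : {linear X k -> X k} := u k \- idfun.
have [||h [h0 hE]] := @null_homotopy n X X d d v dex dex X_inj.
- by move=> k kn x; rewrite /v /= uch // linearB.
- by move=> x; rewrite /v /= u0 subrr.
have dd := exact_upto_dd dex.
have key k : (k < n)%N -> forall z, d k.+1 z = 0 -> u k.+1 z = 0 ->
    z = - d k (h k z).
  move=> kn z dz uz; have := hE k kn z; rewrite /v /= uz dz linear0 add0r sub0r.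
  by move=> <-; rewrite opprK.
move=> k kn; apply: linear_injective => y uy; apply/eqP/negP => /negP y0.
have [||x []] := ess k (fun w => `[< u k.+1 w = 0 >]).
- split=> [|a w w' /asboolP uw /asboolP uw']; apply/asboolP.
    by rewrite linear0.
  by rewrite linearP uw uw' scaler0 addr0.
- by exists y => //; apply/asboolP.
move=> /asboolP; move: (dd k kn x); move: (d k x) => z {x}.
(* z is a nonzero element of K; in degree 1 the homotopy h_0 = 0 already
   excludes it, in higher degrees a nonzero boundary in h K does. *)
move=> dz uz; have := key k kn z dz uz; case: k => [|k] in kn y uy y0 z dz uz *.
  by move=> ->; rewrite h0 !linear0 eqxx.
move=> zE z0.
have [||x []] := ess k (fun w => `[< exists c,
    [/\ d k.+2 c = 0, u k.+2 c = 0 & h k.+1 c = w] >]).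
- split=> [|a _ _ /asboolP[c [dc uc <-]] /asboolP[c' [dc' uc' <-]]].
    by apply/asboolP; exists 0; rewrite !linear0.
  apply/asboolP; exists (a *: c + c'); rewrite !linearP dc uc dc' uc'.
  by rewrite !scaler0 !addr0.
- exists (h k.+1 z); first by apply/asboolP; exists z.
  by apply: contraNneq z0 => hz; rewrite zE hz !linear0.
move=> /asboolP[c [dc uc hc]] /eqP[].
have := key _ kn c dc uc; rewrite hc (dd k (ltnW kn)) oppr0 => c0.
by rewrite -hc c0 linear0.
Qed.

End Modules.

Section Coresolutions.
Variable R : pzRingType.
Implicit Types M N E A B F P : lmodType R.

(** * Finite products of modules and maps *)

Definition pair_lin M N N' (f : {linear M -> N}) (g : {linear M -> N'}) (x : M)
  : (N * N')%type := (f x, g x).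

Fact pair_lin_linear M N N' f g : linear (@pair_lin M N N' f g).
Proof. by move=> a x y; rewrite /pair_lin !linearP. Qed.

HB.instance Definition _ M N N' f g :=
  GRing.isLinear.Build R _ _ _ (@pair_lin M N N' f g) (pair_lin_linear f g).

Definition ffun_lin M N (T : finType) (f : T -> {linear M -> N}) (x : M)
  : {ffun T -> N} := [ffun t => f t x].

Fact ffun_lin_linear M N T f : linear (@ffun_lin M N T f).
Proof. by move=> a x y; apply/ffunP => t; rewrite !ffunE linearP. Qed.

HB.instance Definition _ M N T f :=
  GRing.isLinear.Build R _ _ _ (@ffun_lin M N T f) (ffun_lin_linear f).

Definition ffun_eval M (T : finType) (t : T) (x : {ffun T -> M}) : M := x t.

Fact ffun_eval_linear M T t : linear (@ffun_eval M T t).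
Proof. by move=> a x y; rewrite /ffun_eval !ffunE. Qed.

HB.instance Definition _ M T t :=
  GRing.isLinear.Build R _ _ _ (@ffun_eval M T t) (ffun_eval_linear t).

Definition ffun_map M N (T : finType) (f : {linear M -> N})
  : {linear {ffun T -> M} -> {ffun T -> N}} :=
  ffun_lin (fun t => f \o @ffun_eval M T t : {linear _ -> _}).

Lemma ffun_mapE M N (T : finType) (f : {linear M -> N}) x t :
  ffun_map T f x t = f (x t).
Proof. by rewrite ffunE. Qed.

Lemma injective_prod E E' :
  injective_module E -> injective_module E' ->
  injective_module (E * E')%type.
Proof.
move=> E_inj E'_inj M N i f i_inj.
have [h hE] := E_inj _ _ i (fst \o f : {linear _ -> _}) i_inj.
have [h' h'E] := E'_inj _ _ i (snd \o f : {linear _ -> _}) i_inj.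
exists (pair_lin h h') => x; rewrite /= /pair_lin hE h'E /=.
by case: (f x).
Qed.

Lemma injective_ffun (T : finType) E :
  injective_module E -> injective_module {ffun T -> E}.
Proof.
move=> E_inj M N i f i_inj.
have /choice[h hE] t : exists h : {linear N -> E}, forall x, h (i x) = f x t.
  exact: (E_inj _ _ i (@ffun_eval E T t \o f : {linear _ -> _}) i_inj).
by exists (ffun_lin h) => x; apply/ffunP => t; rewrite ffunE hE.
Qed.

Lemma ffun_map_inj M N (T : finType) (f : {linear M -> N}) :
  injective f -> injective (ffun_map T f).
Proof.
by move=> f_inj x y /ffunP fxy; apply/ffunP => t; apply: f_inj;
  rewrite -!ffun_mapE.
Qed.

Lemma ffun_map_exact (T : finType) M N N' (f : {linear M -> N})
    (g : {linear N -> N'}) :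
  exact_at f g -> exact_at (ffun_map T f) (ffun_map T g).
Proof.
move=> fg y; split=> [/ffunP gy0|[x <-]]; last first.
  by apply/ffunP => t; rewrite !ffun_mapE ffunE; apply/fg; exists (x t).
have /choice[x xE] t : exists x, f x = y t.
  by apply/fg; rewrite -ffun_mapE gy0 ffunE.
by exists (finfun x); apply/ffunP => t; rewrite ffun_mapE ffunE.
Qed.

(** * Injective resolutions with terms cogenerated by a fixed sequence *)

Definition aug_obj A (J : nat -> lmodType R) (k : nat) : lmodType R :=
  if k is k'.+1 then J k' else A.

Definition aug_diff A (J : nat -> lmodType R) (e : {linear A -> J 0%N})
    (d : forall k, {linear J k -> J k.+1}) (k : nat) :
    {linear aug_obj A J k -> aug_obj A J k.+1} :=
  match k with 0%N => e | k'.+1 => d k' end.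

Lemma mir_exact_upto A (I : min_inj_resolution A) n :
  exact_upto n (aug_diff (mir_aug I) (mir_diff I)).
Proof.
by split=> [_|[|k] _]; [exact: mir_aug_inj|exact: mir_exact0|exact: mir_exact].
Qed.

Variable E : nat -> lmodType R.

(** [M] embeds in a finite sum of copies of [E 0], ..., [E k].  The embedding is
kept as a jointly injective family of maps, indexed by all [j] and tested on
[j <= k] only, so that changing [k] needs no transport between index types. *)
Definition cogenerated (k : nat) M : Prop :=
  exists (T : finType) (l : T -> forall j, {linear M -> E j}),
    forall x, (forall t j, (j <= k)%N -> l t j x = 0) -> x = 0.

Lemma cogenerated_le k k' M :
  (k <= k')%N -> cogenerated k M -> cogenerated k' M.
Proof.
move=> kk' [T [l lP]]; exists T, l => x lx; apply: lP => t j jk.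
exact: lx (leq_trans jk kk').
Qed.

(** The family of maps is the identity on [E k] and zero elsewhere; the existence
statement hides the transport along [k = j] that defines it. *)
Lemma cogenerated_self k : cogenerated k (E k).
Proof.
have ex j : exists f : {linear E k -> E j},
    forall e : k = j, forall x, f x = 0 -> x = 0.
  have [<-|kj] := eqVneq k j; first by exists idfun.
  by exists \0%R => e; rewrite e eqxx in kj.
exists unit, (fun _ j => sval (cid (ex j))) => x /(_ tt k (leqnn k)).
exact: (svalP (cid (ex k)) erefl).
Qed.

Lemma cogenerated_prod k M N :
  cogenerated k M -> cogenerated k N -> cogenerated k (M * N)%type.
Proof.
move=> [T [l lP]] [T' [l' l'P]].
exists (T + T')%type, (fun s j => match s with
  | inl t => l t j \o fst : {linear _ -> _}
  | inr t => l' t j \o snd : {linear _ -> _} end).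
move=> [x y] lxy; congr (_, _).
  by apply: lP => t j jk; exact: (lxy (inl t) j jk).
by apply: l'P => t j jk; exact: (lxy (inr t) j jk).
Qed.

Lemma cogenerated_ffun k (T : finType) M :
  cogenerated k M -> cogenerated k {ffun T -> M}.
Proof.
move=> [U [l lP]].
exists (T * U)%type, (fun s j => l s.2 j \o @ffun_eval M T s.1 : {linear _ -> _}).
move=> x lx; apply/ffunP => t; rewrite ffunE; apply: lP => u j jk.
exact: (lx (t, u) j jk).
Qed.

Lemma cogenerated_dsum k M : cogenerated k M ->
  exists (X : Type)
    (f : {linear M -> dsum (fun _ : X => dsum (fun j : 'I_k.+1 => E j))}),
    injective f.
Proof.
move=> [T [l lP]]; exists T.
pose g x : dsum (fun _ : T => dsum (fun j : 'I_k.+1 => E j)) :=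
  @DSum R T (fun=> dsum _)
    (fun t => @DSum R 'I_k.+1 (fun j => E j) (fun j => l t j x) (finite_finset))
    (finite_finset).
have g_lin : linear g.
  move=> a x y; apply: dsumP => t; apply: dsumP => j /=.
  by rewrite linearP.
pose gM := GRing.isLinear.Build R _ _ _ g g_lin.
pose gL : {linear M -> dsum (fun _ : T => dsum (fun j : 'I_k.+1 => E j))} :=
  HB.pack g gM.
exists gL; apply: linear_injective => x gx0; apply: lP => t j jk.
rewrite -[LHS]/(g x t (Ordinal (jk : (j < k.+1)%N))).
by have -> : g x = 0 := gx0.
Qed.

(** A resolution that is only exact as far as the [n]-th term: the bottom module of
a syzygy sequence need not have an injective resolution of the required form,
so each step of the induction can only give one more degree. *)
Definition coresolvable (n : nat) A : Prop :=
  exists (J : nat -> lmodType R) (e : {linear A -> J 0%N})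
         (d : forall k, {linear J k -> J k.+1}),
    [/\ exact_upto n (aug_diff e d), forall k, injective_module (J k) &
        forall k, cogenerated k (J k)].

(** The mapping cone of a lift [f] of [b], with [F] and [B] cut off.  The index
shift costs nothing in [cogenerated k], because [Z] enters one degree late, and
it is what raises the length from [n] for [B] to [n + 1] for [A]. *)
Lemma coresolvable_kernel n A F B (a : {linear A -> F}) (b : {linear F -> B}) :
  injective a -> exact_at a b -> surjective b ->
  coresolvable n.+1 F -> coresolvable n B -> coresolvable n.+1 A.
Proof.
move=> a_inj ab b_surj [Y [eY [dY [Yex Y_inj Y_cog]]]].
move=> [Z [eZ [dZ [Zex Z_inj Z_cog]]]].
have Yex' : exact_upto n (aug_diff eY dY).
  by case: Yex => Y0 Yex; split=> [_|k kn]; [apply: Y0|apply/Yex/ltnW].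
have [f [f0 fch]] :=
  @lift_chain _ n (aug_obj F Y) (aug_obj B Z) _ _ b Yex' Zex Z_inj.
have Ydd := exact_upto_dd Yex; have Zdd := exact_upto_dd Zex.
case: Yex Zex => /(_ isT) Y0 Yex [Z0 Zex].
pose C k : lmodType R := if k is k'.+1 then (Y k'.+1 * Z k')%type else Y 0%N.
pose d k : {linear C k -> C k.+1} := match k with
  | 0%N => pair_lin (dY 0%N) (f 1%N)
  | k'.+1 => pair_lin (dY k'.+1 \o fst)
      ((f k'.+2 \o fst) \- (dZ k' \o snd))
  end.
exists C, (eY \o a : {linear _ -> _}), d; split.
- split=> [_|]; first by apply: inj_comp.
  have pair0P M N (p : (M * N)%type) : p = 0 <-> p.1 = 0 /\ p.2 = 0.
    by case: p => x y; split=> [[-> ->]|[/= -> ->]].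
  move=> [|[|k]] kn.
  + move=> y; rewrite [X in X = 0 <-> _]/=; split=> [/pair0P[/=]|[x <-]].
      move=> /(Yex 0%N kn)[p <-]; rewrite (fch 0%N kn) f0.
      by move=> /(linear_injective0 (Z0 kn)) /ab[x <-]; exists x.
    apply/pair0P; split; first exact: (Ydd 0%N kn).
    rewrite /= (fch 0%N kn) f0.
    by have /ab -> : exists x', a x' = a x; [exists x | rewrite linear0].
  (* Surjectivity of b is used here: the error is an element c of B, which is
     corrected by a preimage of c in F. *)
  + have n0 := ltnW kn; move=> [y z]; split=> [/pair0P[/=]|[x [<- <-]]].
      move=> /(Yex 1%N kn)[x <-]; rewrite (fch 1%N kn) -linearB => fxz.
      have [c cE] : exists c, eZ c = f 1%N x - z by apply/(Zex 0%N kn).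
      have [p pc] := b_surj c; exists (x - eY p); congr (_, _).
        by rewrite linearB (Ydd 0%N n0) subr0.
      by rewrite linearB (fch 0%N n0) f0 pc [aug_diff _ _ _ _]cE opprB addrC subrK.
    apply/pair0P; split; first exact: (Ydd 1%N kn).
    by rewrite /= (fch 1%N kn) subrr.
  + move=> [y z]; split=> [/pair0P[/=]|[[x w] [<- <-]]].
      move=> /(Yex k.+2 kn)[x <-]; rewrite (fch k.+2 kn) -linearB => fxz.
      have [w wE] : exists w, dZ k w = f k.+2 x - z by apply/(Zex k.+1 kn).
      by exists (x, w); congr (_, _); rewrite /= wE opprB addrC subrK.
    apply/pair0P; split; first exact: (Ydd k.+2 kn).
    by rewrite /= (fch k.+2 kn) linearB (Zdd k.+1 kn) subr0 subrr.
- case=> [|k]; first exact: Y_inj.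
  exact: injective_prod (Y_inj k.+1) (Z_inj k).
- case=> [|k]; first exact: Y_cog.
  apply: cogenerated_prod (Y_cog k.+1) _.
  exact: cogenerated_le (leqnSn k) (Z_cog k).
Qed.

Lemma coresolvable0 A : injective_module (E 0%N) -> coresolvable 0 A.
Proof.
move=> E_inj; exists (fun=> E 0%N), \0%R, (fun=> \0%R); split=> // k.
exact: cogenerated_le (leq0n k) (cogenerated_self 0).
Qed.

Lemma finitely_generated_cover P : finitely_generated P ->
  exists (r : nat) (g : {linear {ffun 'I_r -> R^o} -> P}), surjective g.
Proof.
move=> [r [v vP]].
pose g (c : {ffun 'I_r -> R^o}) : P := \sum_(i < r) (c i : R) *: v i.
have g_lin : linear g.
  move=> a x y; rewrite /g scaler_sumr -big_split; apply: eq_bigr => i _ /=.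
  by rewrite !ffunE scalerDl -scalerA.
pose gM := GRing.isLinear.Build R _ _ _ g g_lin.
exists r, (HB.pack_for {linear {ffun 'I_r -> R^o} -> P} g gM) => y.
have [c ->] := vP y; exists (finfun c).
by apply: eq_bigr => i _; rewrite ffunE.
Qed.

End Coresolutions.

(** * Projective modules and syzygies *)

Section Syzygies.
Variables (R : pzRingType) (IR : min_inj_resolution (R^o : lmodType R)).

Lemma coresolvable_free n (T : finType) :
  coresolvable IR n {ffun T -> R^o}.
Proof.
have [I0 Iex] := mir_exact_upto IR n.
exists (fun k => {ffun T -> IR k}), (ffun_map T (mir_aug IR)),
  (fun k => ffun_map T (mir_diff IR k)); split.
- split=> [n0|]; first exact: ffun_map_inj (I0 n0).
  by move=> [|k] kn; apply: ffun_map_exact; exact: (Iex _ kn).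
- by move=> k; apply/injective_ffun/mir_injective.
- by move=> k; apply/cogenerated_ffun/cogenerated_self.
Qed.

(** The retract [P] of a free module [F] is the kernel of [q = 1 - s g], whose
image is again a retract of [F]; so the induction on the length can be run on
retracts, and it needs no resolution of the complement beforehand. *)
Lemma coresolvable_retract n (T : finType) (P : lmodType R)
    (s : {linear P -> {ffun T -> R^o}}) (g : {linear {ffun T -> R^o} -> P}) :
  (forall x, g (s x) = x) -> coresolvable IR n P.
Proof.
elim: n P s g => [|n IHn] P s g gs; first exact/coresolvable0/mir_injective.
pose q : {linear {ffun T -> R^o} -> {ffun T -> R^o}} := idfun \- (s \o g).
apply: (@coresolvable_kernel _ _ n P _ (image_module q) s (im_corestr q)).
- exact: can_inj gs.
- move=> y; split=> [/(congr1 (im_incl q))|[x <-]].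
    by move=> /eqP; rewrite /= subr_eq0 => /eqP ys; exists (g y).
  by apply: val_inj; rewrite /= gs subrr.
- exact: im_corestr_surj.
- exact: coresolvable_free.
- apply: (IHn _ (im_incl q) (im_corestr q)) => y; apply: im_incl_inj.
  have [x <-] := im_inclP y; rewrite /= linearB /=.
  by rewrite gs subrr linear0 subr0.
Qed.

Lemma coresolvable_projective n (P : lmodType R) :
  finitely_generated P -> projective P -> coresolvable IR n P.
Proof.
move=> /finitely_generated_cover[r [g g_surj]] /(_ _ _ g idfun g_surj)[s gs].
exact: coresolvable_retract gs.
Qed.

Lemma coresolvable_syzygy n (A : lmodType R) :
  (0 < n)%N -> is_syzygy n A -> coresolvable IR n A.
Proof.
case: n => // n _ [X [d [e [e_bij d_inj d_ex d_surj [X_fg X_proj]]]]].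
have P_res k m : (k < n.+1)%N -> coresolvable IR m (X k.+1).
  by move=> kn; apply: coresolvable_projective (X_proj k kn); apply/X_fg/leqW.
(* The cycles of the sequence, up to isomorphism: the quotient of X_(k+2) by the
   next cycles is realized as the image of d_(k+1), which is the kernel of d_k. *)
have main k : (k < n.+1)%N -> forall (B : lmodType R) (a : {linear B -> X k.+1}),
    injective a -> exact_at a (d k) -> coresolvable IR k.+1 B.
  elim: k => [|k IHk] kn B a a_inj a_ex.
    apply: coresolvable_kernel a_inj a_ex d_surj (P_res _ _ kn) _.
    exact/coresolvable0/mir_injective.
  apply: (@coresolvable_kernel _ _ _ _ _ (image_module (d k.+1)) a
    (im_corestr (d k.+1))).
  - exact: a_inj.
  - move=> y; rewrite -a_ex; split=> [/(congr1 (im_incl _)) //|dy0].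
    exact: val_inj.
  - exact: im_corestr_surj.
  - exact: P_res.
  - apply: (IHk (ltnW kn) _ (im_incl (d k.+1))); first exact: im_incl_inj.
    move=> y; rewrite (d_ex k (ltnW kn)); split=> [[x <-]|[z <-]].
      by exists (im_corestr (d k.+1) x).
    exact: im_inclP.
apply: (main n (leqnn _) A (d n.+1 \o e : {linear _ -> _})).
- exact: inj_comp d_inj (bij_inj e_bij).
- move=> y; rewrite (d_ex n (leqnn _)); split=> [[x <-]|[x <-]].
    by have [e' _ eK] := e_bij; exists (e' x); rewrite /= eK.
  by exists (e x).
Qed.

End Syzygies.

(** * Minimal resolutions embed in arbitrary ones *)

Section Comparison.
Variable R : pzRingType.

Lemma min_inj_resolution_embed (A : lmodType R) (I : min_inj_resolution A)
    n (J : nat -> lmodType R) (e : {linear A -> J 0%N})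
    (d : forall k, {linear J k -> J k.+1}) :
  exact_upto n (aug_diff e d) -> (forall k, injective_module (J k)) ->
  forall k, (k < n)%N -> exists f : {linear I k -> J k}, injective f.
Proof.
move=> Jex J_inj k kn; have Iex := mir_exact_upto I.
have [f [f0 fch]] := @lift_chain _ n (aug_obj A I) (aug_obj A J) _ _
  idfun (Iex n) Jex J_inj.
have [g [g0 gch]] := @lift_chain _ n (aug_obj A J) (aug_obj A I) _ _
  idfun Jex (Iex n) (@mir_injective _ _ I).
exists (f k.+1).
have := @minimal_retract_injective _ n (aug_obj A I) _
  (fun m => g m \o f m : {linear _ -> _}) (Iex n.+1) (@mir_injective _ _ I).
move=> /(_ _ _ _ k kn) gf_inj.
have {}gf_inj : injective (g k.+1 \o f k.+1).
  apply: gf_inj.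
  - by case=> [|m]; [exact: mir_essential0|exact: mir_essential].
  - by move=> m mn x /=; rewrite (fch m mn) (gch m mn).
  - by move=> x /=; rewrite g0 f0.
exact: inj_compr gf_inj.
Qed.

(** If [h] is a retraction of [f], the complement is the image of the projection
[1 - f h]. *)
Lemma injective_direct_summand (E M : lmodType R) (f : {linear E -> M}) :
  injective_module E -> injective f -> direct_summand E M.
Proof.
move=> E_inj f_inj; have [h hf] := E_inj _ _ f idfun f_inj.
pose q : {linear M -> M} := idfun \- (f \o h).
have hq y : h (q y) = 0 by rewrite /= linearB /= hf subrr.
pose s : {linear (E * image_module q)%type -> M} :=
  (f \o fst) \+ (im_incl q \o snd).
exists (image_module q), s.
exists (fun y => (h y, im_corestr q y)) => [[x c]|y]; last first.
  by rewrite /= addrC subrK.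
have hc : h (im_incl q c) = 0 by have [y <-] := im_inclP c; exact: hq.
have hs : h (s (x, c)) = x by rewrite /= linearD hf hc addr0.
congr (_, _) => //; apply: val_inj; rewrite [LHS]/= -[h _]/(h (s (x, c))) hs.
by rewrite /= addrC addKr.
Qed.

End Comparison.

Theorem proposition2p2 (R : pzRingType)
    (R_left : left_noetherian R) (R_right : right_noetherian R)
    (n : nat) (n_ge1 : (1 <= n)%N)
    (A : lmodType R) (A_syz : is_syzygy n A)
    (IA : min_inj_resolution A) (IR : min_inj_resolution (R^o : lmodType R))
    (i : nat) (i_le : (i <= n.-1)%N) :
  exists X : Type,
    direct_summand (IA i) (dsum (fun _ : X => dsum (fun j : 'I_i.+1 => IR j))).
Proof.
have i_lt : (i < n)%N by rewrite -(prednK n_ge1).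
have [J [e [d [Jex J_inj J_cog]]]] := coresolvable_syzygy IR n_ge1 A_syz.
have [f f_inj] := min_inj_resolution_embed IA Jex J_inj i_lt.
have [X [g g_inj]] := cogenerated_dsum (J_cog i).
exists X; apply: (@injective_direct_summand _ _ _ (g \o f : {linear _ -> _})).
  exact: mir_injective.
exact: inj_comp.
Qed.
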